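(* Let $(A,\dashv,\perp,\vdash)$ be an associative trialgebra. Then $(A,\dashv,\vdash,\perp)$ is a $-1$-tridendriform algebra, that is, a $q$-tridendriform algebra with $q=-1$ whose third product is $\perp$.
   Context: $\mathbb{K}$ is a field of characteristic different from 2. (This is the trivially graded case.) An associative trialgebra is a $\mathbb{K}$-vector space $A$ with three bilinear associative operations $\dashv,\perp,\vdash:A\otimes A\to A$ such that for all $x,y,z\in A$: $(x\dashv y)\dashv z=x\dashv(y\vdash z)=x\dashv(y\perp z)$; $(x\vdash y)\dashv z=x\vdash(y\dashv z)$; $(x\dashv y)\vdash z=x\vdash(y\vdash z)=(x\perp y)\vdash z$; $(x\perp y)\dashv z=x\perp(y\dashv z)$; $(x\dashv y)\perp z=x\perp(y\vdash z)$; $(x\vdash y)\perp z=x\vdash(y\perp z)$. For $q\in\mathbb{K}$, a $q$-tridendriform algebra $(A,\dashv,\vdash,\cdot)$ is a $\mathbb{K}$-vector space $A$ with three bilinear maps $\dashv,\vdash,\cdot:A\otimes A\to A$ such that for all $x,y,z\in A$: $(x\dashv y)\dashv z=x\dashv(y\dashv z+y\vdash z+q\,y\cdot z)$; $(x\vdash y)\dashv z=x\vdash(y\dashv z)$; $x\vdash(y\vdash z)=(x\dashv y+x\vdash y+q\,x\cdot y)\vdash z$; $(x\dashv y)\cdot z=x\cdot(y\vdash z)$; $(x\vdash y)\cdot z=x\vdash(y\cdot z)$; $(x\cdot y)\dashv z=x\cdot(y\dashv z)$; $(x\cdot y)\cdot z=x\cdot(y\cdot z)$. *)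

(* Defs.v *)
From mathcomp Require Import all_boot all_order all_algebra.

Set Implicit Arguments.
Unset Strict Implicit.
Unset Printing Implicit Defensive.

Import GRing.Theory.
Local Open Scope ring_scope.

Section Structures.
Variables (K : fieldType) (A : lmodType K).

Local Notation is_bilinear op := (bilinear_for *:%R *:%R op).

Section TrialgebraLaws.
Variables dashv perp vdash : A -> A -> A.
Local Notation "x ⊣ y" := (dashv x y) (at level 40, left associativity).
Local Notation "x ⊥ y" := (perp x y) (at level 40, left associativity).
Local Notation "x ⊢ y" := (vdash x y) (at level 40, left associativity).

Record is_associative_trialgebra : Prop := AssociativeTrialgebra {
  trialg_bilinear_dashv : is_bilinear dashv;
  trialg_bilinear_perp : is_bilinear perp;
  trialg_bilinear_vdash : is_bilinear vdash;
  trialg_dashvA : associative dashv;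
  trialg_perpA : associative perp;
  trialg_vdashA : associative vdash;
  trialg_dashv_vdash x y z : (x ⊣ y) ⊣ z = x ⊣ (y ⊢ z);
  trialg_dashv_perp x y z : (x ⊣ y) ⊣ z = x ⊣ (y ⊥ z);
  trialg_vdash_dashv x y z : (x ⊢ y) ⊣ z = x ⊢ (y ⊣ z);
  trialg_dashv_vdashl x y z : (x ⊣ y) ⊢ z = x ⊢ (y ⊢ z);
  trialg_perp_vdashl x y z : x ⊢ (y ⊢ z) = (x ⊥ y) ⊢ z;
  trialg_perp_dashv x y z : (x ⊥ y) ⊣ z = x ⊥ (y ⊣ z);
  trialg_dashv_perp_vdash x y z : (x ⊣ y) ⊥ z = x ⊥ (y ⊢ z);
  trialg_vdash_perp x y z : (x ⊢ y) ⊥ z = x ⊢ (y ⊥ z)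
}.
End TrialgebraLaws.

Section TridendriformLaws.
Variables (q : K) (dashv vdash cdot : A -> A -> A).
Local Notation "x ⊣ y" := (dashv x y) (at level 40, left associativity).
Local Notation "x ⊢ y" := (vdash x y) (at level 40, left associativity).
Local Notation "x ⋅ y" := (cdot x y) (at level 40, left associativity).

Record is_tridendriform : Prop := Tridendriform {
  tridend_bilinear_dashv : is_bilinear dashv;
  tridend_bilinear_vdash : is_bilinear vdash;
  tridend_bilinear_cdot : is_bilinear cdot;
  tridend_dashv_dashv x y z :
    (x ⊣ y) ⊣ z = x ⊣ (y ⊣ z + y ⊢ z + q *: (y ⋅ z));
  tridend_vdash_dashv x y z : (x ⊢ y) ⊣ z = x ⊢ (y ⊣ z);
  tridend_vdash_vdash x y z :
    x ⊢ (y ⊢ z) = (x ⊣ y + x ⊢ y + q *: (x ⋅ y)) ⊢ z;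
  tridend_dashv_cdot x y z : (x ⊣ y) ⋅ z = x ⋅ (y ⊢ z);
  tridend_vdash_cdot x y z : (x ⊢ y) ⋅ z = x ⊢ (y ⋅ z);
  tridend_cdot_dashv x y z : (x ⋅ y) ⊣ z = x ⋅ (y ⊣ z);
  tridend_cdot_cdot x y z : (x ⋅ y) ⋅ z = x ⋅ (y ⋅ z)
}.
End TridendriformLaws.

End Structures.

(* Main.v *)
Require Import Defs.
From mathcomp Require Import all_boot all_order all_algebra.

Import GRing.Theory.
Local Open Scope ring_scope.

(** Five of the seven tridendriform identities hold in every trialgebra, being
    mixed associativity laws or the associativity of the middle product.  The
    other two involve the sum [y ⊣ z + y ⊢ z - y ⊥ z].  In a trialgebra,
    [x ⊣ _] cannot distinguish the three products of [y] and [z]: each is sent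
    to [(x ⊣ y) ⊣ z]; symmetrically, [_ ⊢ z] cannot distinguish the three
    products of [x] and [y].  The coefficients [1, 1, -1] of the sum add up
    to [1], so by linearity the sum is sent to that same common value
    (lemma [linear_affine_const]).  This is where [q = -1] comes from: the
    coefficients must satisfy [1 + 1 + q = 1]. *)

(** A linear map constant on three points is constant on their affine
    combinations; here the combination has weights [1, 1, -1]. *)
Lemma linear_affine_const {K : fieldType} {U V : lmodType K} {f : U -> V}
    (f_lin : linear f) {v : V} {a b c : U} :
  f a = v -> f b = v -> f c = v -> f (a + b + (-1) *: c) = v.
Proof.
move=> fa fb fc.
by rewrite addrC f_lin -[a]scale1r f_lin fa fb fc scale1r scaleN1r addKr.
Qed.

Theorem theorem3p26 (K : fieldType) (charK : 2%N \notin [pchar K])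
    (A : lmodType K) (dashv perp vdash : A -> A -> A) :
  is_associative_trialgebra dashv perp vdash ->
  is_tridendriform (-1) dashv vdash perp.
Proof.
case=> bil_dashv bil_perp bil_vdash dashvA perpA vdashA dashv_vdash dashv_perp
  vdash_dashv dashv_vdashl perp_vdashl perp_dashv dashv_perp_vdash vdash_perp.
split=> // x y z.
- have [_ lin_r] := bil_dashv.
  by symmetry; apply: (linear_affine_const (lin_r x)).
- have [lin_l _] := bil_vdash.
  by symmetry; apply: (linear_affine_const (lin_l z)).
Qed.
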